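(* Let $p>1$ be a real number. For each integer $n\ge 1$ let \[ s(n)=\sum_{1\le x_1\le x_2<x_3\le x_4<\cdots\prec x_n}(x_1x_2\cdots x_n)^{-p},\qquad k_n=n\,\bigl(s(n)\bigr)^{\frac{1}{np}} .\] Then \[ \lim_{n\to\infty}k_n=\frac{e}{p}\,B\!\left(\frac{1}{2p},\,1-\frac1p\right). \]
   Context: The sum defining $s(n)$ runs over all $n$-tuples $(x_1,\dots,x_n)$ of positive integers such that $x_{j}\le x_{j+1}$ for every odd $j$ with $1\le j\le n-1$, and $x_j<x_{j+1}$ for every even $j$ with $1\le j\le n-1$ (so the last sign $\prec$, between $x_{n-1}$ and $x_n$, is $\le$ if $n$ is even and $<$ if $n$ is odd). $B$ denotes the Euler beta function, and $e$ is the base of natural logarithms. *)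

(* Defs.v *)
From HB Require Import structures.
From mathcomp Require Export all_boot all_order all_algebra.
From mathcomp Require Export all_classical all_reals all_analysis.

Set Implicit Arguments.
Unset Strict Implicit.
Unset Printing Implicit Defensive.

Import Order.TTheory GRing.Theory Num.Theory.
Import numFieldNormedType.Exports.

Local Open Scope classical_set_scope.
Local Open Scope ring_scope.

(* The tuples (x_1, ..., x_n) of positive integers with
   x_1 <= x_2 < x_3 <= x_4 < ... ; since tuples are indexed from 0,
   x_j is [nth 0 x j.-1] and x_(j+1) is [nth 0 x j]. *)
Definition alternating_chain (n : nat) : set (n.-tuple nat) :=
  [set x | (forall i : 'I_n, (0 < tnth x i)%N) /\
           (forall j : nat, (1 <= j <= n - 1)%N ->
              if odd j then (nth 0%N x j.-1 <= nth 0%N x j)%N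
              else (nth 0%N x j.-1 < nth 0%N x j)%N)].
Arguments alternating_chain : clear implicits.

(* An unordered sum of nonnegative terms, a priori in [0, +oo]. *)
Definition s (R : realType) (p : R) (n : nat) : \bar R :=
  (\esum_(x in alternating_chain n)
     ((\prod_(i < n) (tnth x i)%:R) `^ (- p))%R%:E)%E.

(* Extended-real valued, like s; only the values for n >= 1 are meaningful. *)
Definition k (R : realType) (p : R) (n : nat) : \bar R :=
  (n%:R%:E * s p n `^ (1 / (n%:R * p))%R)%E.

(* Euler's beta integral for real a, b > 0; the library's [beta_fun] only has
   natural-number parameters. *)
Definition euler_beta (R : realType) (a b : R) : R :=
  \int[@lebesgue_measure R]_(t in `]0, 1[) (t `^ (a - 1) * (1 - t) `^ (b - 1)).

(* Main.v *)
Require Import Defs.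
From mathcomp Require Import all_boot all_order all_algebra.
From mathcomp Require Import all_classical all_reals all_analysis.
From mathcomp Require Import measurable_realfun ring lra zify.
Set Implicit Arguments.
Unset Strict Implicit.
Unset Printing Implicit Defensive.
Import Order.TTheory GRing.Theory Num.Theory.
Import numFieldNormedType.Exports.
Local Open Scope classical_set_scope.
Local Open Scope ring_scope.

(** Write y_k = t * k^-p.  Reading a chain by the values k = 1, 2, 3, ...,
    each value occurs at most twice, and twice only from an odd place to the
    next one; so the generating function of s is an infinite product of
    transfer matrices [[1 + y_k^2, y_k], [y_k, 1]] acting on the pair
    (chains of even length, chains of odd length).  Such a matrix has
    determinant 1, and its largest eigenvalue is rho(y_k)^2, where rho(y) is
    the positive root of X^2 = 1 + y X; the eigenvector is (1, 1 / rho(y_k)).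
    Since y_k decreases with k these eigenvectors are ordered, which makes the
    product of the eigenvalues both a lower bound and, up to a factor 2, an
    upper bound for the generating function: [even_odd_part_le] and
    [rho_prod_le].

    The logarithm of that product is a sum of terms ln (rho(y_k)^2), each the
    integral of du/u over the u in ]0, 1[ above rho(y_k)^-2.  With t = T^p the
    condition on u reads k <= T chi(u), where chi(u) =
    u^(1/(2p)) (1 - u)^(-1/p); so the sum is the integral of the number of
    k <= T chi(u) against du/u.  Replacing this number by T chi(u) turns the
    integral into A T, where A = B(1/(2p), 1 - 1/p).  This only increases the
    integral, and by no more than O(sqrt T): [ln_rho_prod_le],
    [ln_rho_prod_ge].

    Hence sum_n s(n) T^(pn) = exp (A T + O(sqrt T)).  Keeping one term gives
    s(n) <= 2 exp (A T) T^(-pn) for every T, and T = pn / A yields the upper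
    bound (e A / (pn))^(pn), up to a constant.  For the lower bound, take T a
    little larger than pn / A, so that by Chernoff's argument nearly all of the
    sum comes from exponents m slightly above n.  Since
    s(m) <= Z^(m - n) s(n) with Z bounding the sum of the j^-p, that part of
    the sum controls s(n) itself.  A window of relative width n^(-1/8) is wide
    enough to beat the O(sqrt T) error, and narrow enough that the loss
    T^(p (m - n)) disappears in the n-th root: [trunc_sum_ge_expR],
    [trunc_sum_ge_optimal]. *)

(** * Truncated sums over alternating chains *)

(** The sum over the chains of length n with last entry at most N, weighted by
    the product of the a j, computed by removing the last entry j.+1: what is
    left must end at most at j.+1 if the last sign is <= and at most at j if it
    is <. *)
Fixpoint trunc_sum {R : realType} (a : nat -> R) (n N : nat) : R :=
  if n is m.+1 then \sum_(j < N) a j.+1 * trunc_sum a m (j + odd m) else 1.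

Lemma trunc_sum0 {R : realType} (a : nat -> R) N : trunc_sum a 0 N = 1.
Proof. by []. Qed.

Lemma trunc_sumS {R : realType} (a : nat -> R) n N :
  trunc_sum a n.+1 N = \sum_(j < N) a j.+1 * trunc_sum a n (j + odd n).
Proof. by []. Qed.

Arguments trunc_sum : simpl never.

Lemma trunc_sumSS {R : realType} (a : nat -> R) n N :
  trunc_sum a n.+1 N.+1 =
  trunc_sum a n.+1 N + a N.+1 * trunc_sum a n (N + odd n).
Proof. by rewrite trunc_sumS big_ord_recr. Qed.

Lemma trunc_sum_ge0 {R : realType} (a : nat -> R) n N :
  (forall j, 0 <= a j) -> 0 <= trunc_sum a n N.
Proof.
move=> a0; elim: n N => [|n IHn] N; rewrite ?trunc_sum0 ?trunc_sumS//.
by apply: sumr_ge0 => j _; rewrite mulr_ge0.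
Qed.

Lemma le_trunc_sum {R : realType} (a : nat -> R) n (M N : nat) :
  (forall j, 0 <= a j) -> (M <= N)%N -> trunc_sum a n M <= trunc_sum a n N.
Proof.
move=> a0; case: n => [//|n] /subnKC <-.
elim: (N - M)%N => [|d IHd]; first by rewrite addn0.
rewrite addnS trunc_sumSS (le_trans IHd)// lerDl.
by rewrite mulr_ge0// trunc_sum_ge0.
Qed.

Lemma trunc_sum_eq0 {R : realType} (a : nat -> R) n N :
  (N.*2 < n)%N -> trunc_sum a n N = 0.
Proof.
elim: n N => [|n IHn] N //= Nn.
rewrite trunc_sumS big1// => j _; rewrite IHn ?mulr0//.
have := ltn_ord j; have := odd_double_half n; lia.
Qed.

(** Lengthening a chain by one entry costs at most a factor Z, since forgetting
    the order condition on the new entry only enlarges the sum. *)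
Lemma trunc_sum_le_geometric {R : realType} (a : nat -> R) (Z : R) n d N :
  (forall j, 0 <= a j) -> (forall M, \sum_(j < M) a j.+1 <= Z) ->
  trunc_sum a (n + d) N <= trunc_sum a n N * Z ^+ d.
Proof.
move=> a0 aZ; have Z0 : 0 <= Z by apply: le_trans (aZ 0%N); rewrite big_ord0.
elim: d => [|d IHd]; first by rewrite addn0 expr0 mulr1.
rewrite addnS exprSr mulrA trunc_sumS.
apply: (@le_trans _ _ (trunc_sum a (n + d) N * Z)); last exact: ler_wpM2r.
apply: (@le_trans _ _ (\sum_(j < N) trunc_sum a (n + d) N * a j.+1)).
  apply: ler_sum => j _; rewrite mulrC ler_wpM2r// le_trunc_sum//.
  by have := ltn_ord j; case: odd => /=; lia.
by rewrite -mulr_sumr ler_wpM2l// trunc_sum_ge0.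
Qed.

Definition chain_upto (n N : nat) : set (n.-tuple nat) :=
  [set x | alternating_chain n x /\ (last 0%N x <= N)%N].
Arguments chain_upto : clear implicits.

Definition zeta_term {R : realType} (p : R) (j : nat) : R := j%:R `^ (- p).

Definition weight {R : realType} (p : R) {n} (x : n.-tuple nat) : R :=
  (\prod_(i < n) (tnth x i)%:R) `^ (- p).

Lemma weight_ge0 {R : realType} (p : R) n (x : n.-tuple nat) : 0 <= weight p x.
Proof. exact: powR_ge0. Qed.

Lemma weight_rcons {R : realType} (p : R) n (x : n.-tuple nat) v :
  weight p [tuple of rcons x v] = zeta_term p v * weight p x.
Proof.
rewrite /weight big_ord_recr/= powRM//; last by rewrite prodr_ge0.
rewrite mulrC; congr (_ `^ _ * _ `^ _).
  by rewrite (tnth_nth 0%N)/= nth_rcons size_tuple ltnn eqxx.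
apply: eq_bigr => i _; rewrite !(tnth_nth 0%N)/= nth_rcons size_tuple.
by rewrite (ltn_ord i).
Qed.

(** For n = 0 the right-hand side is the positivity of v, because the last
    entry of the empty tuple is 0 by default. *)
Lemma alternating_chain_rcons n (x : n.-tuple nat) v :
  alternating_chain n.+1 [tuple of rcons x v] <->
  alternating_chain n x /\ (last 0 x < v + odd n)%N.
Proof.
rewrite /alternating_chain /=.
have szx : size x = n by rewrite size_tuple.
have nlast : last 0%N x = nth 0%N x n.-1 by rewrite -nth_last szx.
split=> [[xpos xinc]|[[xpos xinc] lastx]].
- have vpos : (0 < v)%N.
    have := xpos ord_max.
    by rewrite (tnth_nth 0%N)/= nth_rcons szx ltnn eqxx.
  split; first split.
  + move=> i; have := xpos (widen_ord (leqnSn n) i).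
    by rewrite !(tnth_nth 0%N)/= nth_rcons szx (ltn_ord i).
  + move=> j jn; have := xinc j; rewrite !nth_rcons szx.
    have -> : (j.-1 < n)%N by lia.
    have -> : (j < n)%N by lia.
    by apply; lia.
  + rewrite nlast; case: n => [|n] in x szx xpos xinc nlast *.
      by rewrite (tuple0 x)/= addn0.
    have := xinc n.+1; rewrite !nth_rcons szx ltnn eqxx leqnn.
    by case: odd => /= /(_ ltac:(lia)); lia.
- split.
  + move=> i; rewrite (tnth_nth 0%N)/= nth_rcons szx.
    case: (ltngtP i n) => [ltin|ltni|_].
    * by have := xpos (Ordinal ltin); rewrite (tnth_nth 0%N).
    * by have := ltn_ord i; lia.
    * case: n => [|n] in x szx xpos xinc nlast lastx i *.
        by move: lastx; rewrite addn0; lia.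
      have := xpos ord_max; rewrite (tnth_nth 0%N)/=.
      by move: lastx; rewrite nlast/=; case: odd => /=; lia.
  + move=> j jn; rewrite !nth_rcons szx.
    case: (ltngtP j n) => [jlt|jgt|jeq]; last 2 first.
    * by lia.
    * have -> : (j.-1 < n)%N by lia.
      by subst j; move: lastx; rewrite nlast; case: odd => /=; lia.
    * have -> : (j.-1 < n)%N by lia.
      by apply: xinc; lia.
Qed.

Lemma chain_upto0 N : chain_upto 0 N = [set [tuple]].
Proof.
apply/seteqP; split=> x /=; first by rewrite (tuple0 x).
by move=> ->; split=> //; split=> [[]//|j]; lia.
Qed.

Lemma chain_uptoS0 n : chain_upto n.+1 0 = set0.
Proof.
apply/seteqP; split=> // x [[xpos _]] /=; have := xpos ord_max.
by rewrite (tnth_nth 0%N) -nth_last size_tuple/=; lia.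
Qed.

Lemma chain_uptoSS_last n N :
  chain_upto n.+1 N.+1 `&` [set x | last 0%N x = N.+1] =
  (fun x : n.-tuple nat => [tuple of rcons x N.+1]) @` chain_upto n (N + odd n).
Proof.
apply/seteqP; split=> x /=.
- case: x => s; case/lastP: s => [//|s v] sz; have szs : size s == n.
    by move: (sz); rewrite size_rcons eqSS.
  have -> : Tuple sz = [tuple of rcons (Tuple szs) v] by exact: val_inj.
  rewrite last_rcons => -[[/alternating_chain_rcons[chs lasts] _] vE].
  by exists (Tuple szs); rewrite vE// in lasts *; split=> //; lia.
- move=> [y [chy lasty] <-]; split; last by rewrite last_rcons.
  split; last by rewrite last_rcons.
  by apply/alternating_chain_rcons; split=> //; lia.
Qed.

Lemma chain_uptoSS_notlast n N :
  chain_upto n.+1 N.+1 `&` ~` [set x | last 0%N x = N.+1] = chain_upto n.+1 N.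
Proof.
apply/seteqP; split=> x /= [].
- by move=> [chx lastx] neq; split=> //; move: lastx neq => /=; lia.
- by move=> chx lastx; split; [split=> //|]; lia.
Qed.

Lemma ge0_esumZl {R : realType} {T : choiceType} (A : set T) (r : R)
    (f : T -> \bar R) : 0 <= r -> (forall x, (0 <= f x)%E) ->
  (\esum_(x in A) (r%:E * f x) = r%:E * \esum_(x in A) f x)%E.
Proof.
move=> r0 f0; rewrite /esum -ereal_supZl//; last first.
  by apply/set0P; exists 0%E; exists set0; rewrite ?fsbig_set0//; split.
rewrite image_comp; congr ereal_sup; apply: eq_imagel => /= X [finX XA].
by rewrite ge0_mule_fsumr.
Qed.

(** The chains ending at most at N.+1 split into those ending at most at N and
    those ending exactly at N.+1; this is the recursion of [trunc_sum]. *)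
Lemma esum_chain_upto {R : realType} (p : R) n N :
  (\esum_(x in chain_upto n N) (weight p x)%:E =
   (trunc_sum (zeta_term p) n N)%:E)%E.
Proof.
have w0 m (x : m.-tuple nat) : (0 <= (weight p x)%:E)%E.
  by rewrite lee_fin weight_ge0.
elim: n N => [|n IHn] N.
  by rewrite chain_upto0 esum_set1// trunc_sum0 /weight big_ord0 powR1.
elim: N => [|N IHN].
  by rewrite chain_uptoS0 esum_set0 trunc_sumS big_ord0.
rewrite (esumID [set x : n.+1.-tuple nat | last 0%N x = N.+1])//.
rewrite chain_uptoSS_notlast IHN chain_uptoSS_last esum_image; last first.
  move=> x y _ _ /(congr1 val)/= /rcons_inj[xy]; exact: val_inj.
rewrite addeC trunc_sumSS EFinD EFinM -IHn; congr (_ + _)%E.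
under eq_esum do rewrite weight_rcons EFinM.
by rewrite ge0_esumZl// powR_ge0.
Qed.

Lemma trunc_sum_le_s {R : realType} (p : R) n N :
  ((trunc_sum (zeta_term p) n N)%:E <= s p n)%E.
Proof.
rewrite -esum_chain_upto; apply: ge_ereal_sup => _ [X [finX XA] <-].
by apply: ereal_sup_ubound; exists X => //; split=> // x /XA[].
Qed.

(** A finite set of chains has bounded last entries, so the unordered sum is the
    supremum of the truncated ones. *)
Lemma s_le {R : realType} (p : R) n (B : R) :
  (forall N, trunc_sum (zeta_term p) n N <= B) -> (s p n <= B%:E)%E.
Proof.
move=> tB; apply: ge_ereal_sup => _ [X [finX XA] <-].
have /finite_seqP[r Xr] := finX.
pose N := (\max_(x <- r) last 0 (tval x))%N.
have XN : X `<=` chain_upto n N.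
  move=> x Xx; split; first exact: XA.
  rewrite Xr/= in Xx.
  exact: (@leq_bigmax_seq _ r xpredT (fun x => last 0%N (tval x)) x Xx).
rewrite (le_trans _ (_ : (trunc_sum (zeta_term p) n N)%:E <= _)%E)//.
  by rewrite -esum_chain_upto; apply: ereal_sup_ubound; exists X.
by rewrite lee_fin.
Qed.

(** * Two-sided product bounds for the generating function *)

(** The positive root of X^2 = 1 + y X, that is exp (asinh (y / 2)). *)
Definition rho {R : realType} (y : R) : R := (y + Num.sqrt (y ^+ 2 + 4)) / 2.

Lemma rho_sqr {R : realType} (y : R) : rho y ^+ 2 = 1 + y * rho y.
Proof.
have : Num.sqrt (y ^+ 2 + 4) ^+ 2 = y ^+ 2 + 4.
  by rewrite sqr_sqrtr// addr_ge0// sqr_ge0.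
by rewrite /rho; set q := Num.sqrt _ => qE; nra.
Qed.

Lemma rho_ge1 {R : realType} (y : R) : 0 <= y -> 1 <= rho y.
Proof.
move=> y0; have : 2 <= Num.sqrt (y ^+ 2 + 4).
  rewrite -[leLHS]ger0_norm// -sqrtr_sqr ler_wsqrtr//.
  by have := sqr_ge0 y; lra.
by rewrite /rho; lra.
Qed.

Lemma le_rho {R : realType} (y z : R) : 0 <= y -> y <= z -> rho y <= rho z.
Proof.
move=> y0 yz; rewrite /rho ler_pM2r// lerD// ler_wsqrtr// lerD2r.
by rewrite lerXn2r// nnegrE (le_trans y0).
Qed.

Definition rho_prod {R : realType} (a : nat -> R) (t : R) (N : nat) : R :=
  \prod_(j < N) rho (t * a j.+1) ^+ 2.

Lemma rho_prod_ge0 {R : realType} (a : nat -> R) (t : R) N :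
  0 <= rho_prod a t N.
Proof. by apply: prodr_ge0 => j _; rewrite sqr_ge0. Qed.

Definition even_part {R : realType} (a : nat -> R) (t : R) (K N : nat) : R :=
  \sum_(j < K) trunc_sum a j.*2 N * t ^+ j.*2.

Definition odd_part {R : realType} (a : nat -> R) (t : R) (K N : nat) : R :=
  \sum_(j < K) trunc_sum a j.*2.+1 N * t ^+ j.*2.+1.

Lemma sum_even_odd {R : realType} (a : nat -> R) (t : R) K N :
  \sum_(n < K.*2) trunc_sum a n N * t ^+ n =
  even_part a t K N + odd_part a t K N.
Proof.
elim: K => [|K IHK]; first by rewrite /even_part /odd_part !big_ord0 addr0.
rewrite doubleS !big_ord_recr {}IHK /even_part /odd_part !big_ord_recr/=.
by ring.
Qed.

(** [odd_partS] and [even_partS] say together that the pair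
    (even part, odd part) is multiplied by [[1 + y^2, y], [y, 1]] when N grows,
    up to the shift of the cutoff K. *)
Lemma odd_partS {R : realType} (a : nat -> R) (t : R) K N :
  odd_part a t K N.+1 = odd_part a t K N + t * a N.+1 * even_part a t K N.
Proof.
rewrite /odd_part /even_part mulr_sumr -big_split; apply: eq_bigr => j _.
by rewrite trunc_sumSS odd_double addn0/= exprS; ring.
Qed.

Lemma even_partS {R : realType} (a : nat -> R) (t : R) K N :
  even_part a t K.+1 N.+1 =
  even_part a t K.+1 N + t * a N.+1 * odd_part a t K N.+1.
Proof.
rewrite /odd_part /even_part !big_ord_recl -addrA mulr_sumr -big_split.
congr (_ + _); apply: eq_bigr => j _.
by rewrite doubleS trunc_sumSS/= odd_double addn1 exprS; ring.
Qed.

(** The pair of parts stays below a multiple of (1, 1 / rho y), where y belongs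
    to the next index: this vector is an eigenvector of the next matrix, and
    it increases with N because y decreases. *)
Lemma even_odd_part_le {R : realType} (a : nat -> R) (t : R) K N :
  (forall j, 0 <= a j) -> (forall j, a j.+2 <= a j.+1) -> 0 <= t ->
  even_part a t K N <= rho_prod a t N /\
  odd_part a t K N <= rho_prod a t N / rho (t * a N.+1).
Proof.
move=> a0 adec t0; have ta0 j : 0 <= t * a j by rewrite mulr_ge0.
have part0 (f : nat -> nat) J M :
    0 <= \sum_(j < J) trunc_sum a (f j) M * t ^+ (f j).
  by apply: sumr_ge0 => j _; rewrite mulr_ge0 ?exprn_ge0 ?trunc_sum_ge0.
case: K => [|K].
  rewrite /even_part /odd_part !big_ord0 divr_ge0 ?rho_prod_ge0//.
  by rewrite (le_trans _ (rho_ge1 (ta0 _))).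
elim: N => [|N [IHE IHO]].
  rewrite /even_part /odd_part /rho_prod big_ord0 big_ord_recl/= trunc_sum0.
  rewrite mulr1 !big1 => [|j _|j _]; try by rewrite trunc_sum_eq0 ?mul0r.
  by rewrite addr0 divr_ge0// (le_trans _ (rho_ge1 (ta0 _))).
set y := t * a N.+1 in IHE IHO *; set y' := t * a N.+2.
have y1 := rho_ge1 (ta0 N.+1); have y'1 := rho_ge1 (ta0 N.+2).
have y'y : rho y' <= rho y by apply: le_rho; rewrite /y' ?/y ?ler_wpM2l.
have yE := rho_sqr y.
rewrite /rho_prod big_ord_recr/= -/y -/(rho_prod a t N).
rewrite -/y -/y' in y1 y'1.
set L := rho_prod a t N in IHE IHO *.
have L0 : 0 <= L := rho_prod_ge0 _ _ _.
have oddS : odd_part a t K.+1 N.+1 <= L * rho y.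
  rewrite odd_partS (le_trans (lerD IHO (ler_wpM2l (ta0 N.+1) IHE)))//.
  have rV : (rho y)^-1 = rho y - y.
    by apply: (@mulfI _ (rho y)); rewrite ?divff; lra.
  by rewrite rV -/y; lra.
split.
- have oddS' : odd_part a t K N.+1 <= L * rho y.
    apply: le_trans oddS; rewrite /odd_part [leRHS]big_ord_recr/= lerDl.
    by rewrite mulr_ge0 ?exprn_ge0 ?trunc_sum_ge0.
  rewrite even_partS (le_trans (lerD IHE (ler_wpM2l (ta0 N.+1) oddS')))//.
  by rewrite yE -/y; lra.
- apply: (le_trans oddS); rewrite ler_pdivlMr; last by lra.
  by rewrite expr2 mulrA ler_wpM2l// mulr_ge0//; lra.
Qed.

(** The transposed argument: (1, 1 / rho y) is also a left eigenvector.  The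
    condition N < K keeps the cutoff above every chain length that occurs. *)
Lemma rho_prod_le {R : realType} (a : nat -> R) (t : R) K N :
  (forall j, 0 <= a j) -> (forall j, a j.+2 <= a j.+1) -> 0 <= t -> (N < K)%N ->
  rho_prod a t N <=
  even_part a t K N + odd_part a t K N / rho (t * a N.+1).
Proof.
move=> a0 adec t0; have ta0 j : 0 <= t * a j by rewrite mulr_ge0.
case: K => // K; elim: N => [|N IHN] NK.
  rewrite /rho_prod big_ord0 /even_part /odd_part big_ord_recl/= trunc_sum0.
  rewrite mulr1 !big1 => [|j _|j _]; try by rewrite trunc_sum_eq0 ?mul0r.
  by rewrite mul0r !addr0.
have {}IHN := IHN (ltnW NK).
rewrite /rho_prod big_ord_recr/= -/(rho_prod a t N).
set y := t * a N.+1 in IHN *; set y' := t * a N.+2.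
have y1 := rho_ge1 (ta0 N.+1); have y'1 := rho_ge1 (ta0 N.+2).
have y'y : rho y' <= rho y by apply: le_rho; rewrite /y' ?/y ?ler_wpM2l.
have yE := rho_sqr y; rewrite -/y -/y' in y1 y'1.
have rV : (rho y)^-1 = rho y - y.
  by apply: (@mulfI _ (rho y)); rewrite ?divff; lra.
have evenS : even_part a t K.+1 N.+1 =
    even_part a t K.+1 N + y * odd_part a t K.+1 N.+1.
  rewrite even_partS /odd_part [in RHS]big_ord_recr/=.
  by rewrite (@trunc_sum_eq0 _ _ K.*2.+1) ?mul0r ?addr0//; lia.
have O0 : 0 <= odd_part a t K.+1 N.+1.
  by apply: sumr_ge0 => j _; rewrite mulr_ge0 ?exprn_ge0 ?trunc_sum_ge0.
apply: (@le_trans _ _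
    (even_part a t K.+1 N.+1 + odd_part a t K.+1 N.+1 / rho y)); last first.
  by rewrite lerD2l ler_wpM2l// lef_pV2// posrE; lra.
rewrite evenS odd_partS -/y.
rewrite (le_trans (ler_wpM2r (sqr_ge0 _) IHN))// rV yE.
set E := even_part _ _ _ _; set O := odd_part _ _ _ _.
rewrite le_eqVlt; apply/orP; left; apply/eqP.
have h : (rho y - y) * (1 + y * rho y) = rho y.
  by rewrite -yE -rV expr2 mulKf//; lra.
rewrite [LHS](_ : _ =
  E * (1 + y * rho y) + O * ((rho y - y) * (1 + y * rho y))); last by ring.
by rewrite h; ring.
Qed.

Lemma sum_trunc_le {R : realType} (a : nat -> R) (t : R) K N :
  (forall j, 0 <= a j) -> (forall j, a j.+2 <= a j.+1) -> 0 <= t ->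
  \sum_(n < K) trunc_sum a n N * t ^+ n <= 2 * rho_prod a t N.
Proof.
move=> a0 adec t0.
have ta0 : 0 <= t * a N.+1 by rewrite mulr_ge0.
apply: (@le_trans _ _ (\sum_(n < K.*2) trunc_sum a n N * t ^+ n)).
  rewrite -addnn big_split_ord/= lerDl; apply: sumr_ge0 => j _.
  by rewrite mulr_ge0 ?exprn_ge0 ?trunc_sum_ge0.
rewrite sum_even_odd; have [Ele Ole] := even_odd_part_le K N a0 adec t0.
rewrite mulr_natl mulr2n lerD// (le_trans Ole)//.
have r1 := rho_ge1 ta0.
rewrite ler_pdivrMr; last by lra.
by rewrite ler_peMr// rho_prod_ge0.
Qed.

Lemma sum_trunc_ge {R : realType} (a : nat -> R) (t : R) K N :
  (forall j, 0 <= a j) -> (forall j, a j.+2 <= a j.+1) -> 0 <= t ->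
  (N.*2.+1 < K)%N ->
  rho_prod a t N <= \sum_(n < K) trunc_sum a n N * t ^+ n.
Proof.
move=> a0 adec t0 NK.
have ta0 : 0 <= t * a N.+1 by rewrite mulr_ge0.
apply: (@le_trans _ _ (\sum_(n < N.+1.*2) trunc_sum a n N * t ^+ n));
  last first.
  rewrite -(subnKC (_ : N.+1.*2 <= K)%N); last by lia.
  rewrite big_split_ord/= lerDl; apply: sumr_ge0 => j _.
  by rewrite mulr_ge0 ?exprn_ge0 ?trunc_sum_ge0.
rewrite sum_even_odd (le_trans (rho_prod_le a0 adec t0 (ltnSn N)))//.
rewrite lerD2l ler_piMr//.
  by apply: sumr_ge0 => j _; rewrite mulr_ge0 ?exprn_ge0 ?trunc_sum_ge0.
by rewrite invf_le1 ?rho_ge1// (lt_le_trans _ (rho_ge1 ta0)).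
Qed.

(** * Integrability of the beta integrand *)

Lemma integral_is_derive {R : realType} (F f : R -> R) (a b : R) : a < b ->
  (forall x : R, a <= x <= b -> is_derive x 1 F (f x)) ->
  (forall x : R, a <= x <= b -> {for x, continuous f}) ->
  (\int[@lebesgue_measure R]_(x in `[a, b]) (f x)%:E = (F b - F a)%:E)%E.
Proof.
move=> ab dF cf.
have cF x : a <= x <= b -> {for x, continuous F}.
  by move=> /dF[dFx _]; apply/differentiable_continuous/derivable1_diffP.
rewrite (@continuous_FTC2 _ f F)//.
- apply: continuous_in_subspaceT => x; rewrite inE/= in_itv/=; exact: cf.
- split.
  + by move=> x; rewrite in_itv/= => /andP[ax xb]; case: (dF x); rewrite ?ltW.
  + by apply: cvg_at_right_filter; apply: cF; rewrite lexx ltW.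
  + by apply: cvg_at_left_filter; apply: cF; rewrite lexx ltW.
- move=> x; rewrite in_itv/= => /andP[ax xb].
  by rewrite derive1E; have [] := dF x; rewrite ?(ltW ax) ?(ltW xb).
Qed.

Lemma itvoo_bigcup {R : realType} :
  `]0, 1[%classic = \bigcup_n `[n.+3%:R^-1, 1 - n.+3%:R^-1]%classic :> set R.
Proof.
apply/seteqP; split=> x /=.
- rewrite in_itv/= => /andP[x0 x1].
  pose m := Num.min x (1 - x); have m0 : 0 < m by rewrite lt_min x0 subr_gt0.
  pose n := Num.bound m^-1; exists n => //=.
  have nm : n.+3%:R^-1 <= m.
    rewrite -[leRHS]invrK lef_pV2 ?posrE ?invr_gt0//.
    have := archi_boundP (ltW (_ : 0 < m^-1)); rewrite invr_gt0 => /(_ m0).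
    by move=> /ltW/le_trans; apply; rewrite ler_nat /n; lia.
  rewrite in_itv/=; move: nm; rewrite /m le_min => /andP[-> nx] /=.
  by rewrite lerBrDl -lerBrDr.
- move=> [n _]; rewrite /= !in_itv/=.
  have : 0 < n.+3%:R^-1 :> R by rewrite invr_gt0.
  by move: (n.+3%:R^-1) => w w0 /andP[xw wx]; apply/andP; split; lra.
Qed.

(** Monotone convergence over the intervals [1/m, 1 - 1/m], on each of which the
    integral is a difference of two values of F. *)
Lemma integrable_bounded_primitive {R : realType} (F f : R -> R) (M : R) :
  (forall x : R, 0 < x < 1 -> 0 <= f x) ->
  (forall x : R, 0 < x < 1 -> is_derive x 1 F (f x)) ->
  (forall x : R, 0 < x < 1 -> {for x, continuous f}) ->
  (forall x : R, 0 < x < 1 -> `|F x| <= M) ->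
  (@lebesgue_measure R).-integrable `]0, 1[ (EFin \o f).
Proof.
move=> f0 dF cf FM.
have mf : measurable_fun `](0 : R), 1[ f.
  apply: open_continuous_measurable_fun.
    exact: interval_open.
  by move=> x; rewrite inE/= in_itv/=; exact: cf.
apply/integrableP; split; first exact/measurable_EFinP.
under eq_integral => x.
  rewrite inE/= in_itv/= => x01; rewrite ger0_norm ?f0//; over.
pose I n := `[n.+3%:R^-1, 1 - n.+3%:R^-1]%classic : set R.
have I01 n : I n `<=` `]0, 1[ by rewrite itvoo_bigcup; exact: bigcup_sup.
have nI : nondecreasing_seq I.
  apply/nondecreasing_seqP => n; rewrite subsetEset /I => x /=.
  rewrite !in_itv/=.
  have : n.+4%:R^-1 <= n.+3%:R^-1 :> R by rewrite lef_pV2 ?posrE// ler_nat.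
  move: (n.+3%:R^-1) (n.+4%:R^-1) => v w wv /andP[vx xv].
  by apply/andP; split; lra.
rewrite [X in (\int[_]_(x in X) _)%E]itvoo_bigcup.
have mfI n : measurable_fun (I n) (EFin \o f).
  by apply/measurable_EFinP; exact: measurable_funS mf.
have f0I n x : I n x -> (0 <= (EFin \o f) x)%E.
  by move=> /I01/=; rewrite in_itv/= lee_fin; exact: f0.
have mI n : measurable (I n) by exact: measurable_itv.
have cvgI : (\int[@lebesgue_measure R]_(x in I n) (f x)%:E @[n --> \oo] -->
    \int[@lebesgue_measure R]_(x in \bigcup_n I n) (f x)%:E)%E.
  exact: ge0_nondecreasing_set_cvg_integral.
rewrite -(cvg_lim _ cvgI)//.
apply: (@le_lt_trans _ _ (M + M)%:E); last exact: ltry.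
apply: lime_le.
  by apply/cvg_ex; eexists; exact: cvgI.
apply: nearW => n.
have n3 : n.+3%:R^-1 <= 3^-1 :> R by rewrite lef_pV2 ?posrE// ler_nat.
have n0 : 0 < n.+3%:R^-1 :> R by rewrite invr_gt0.
rewrite /I; move: (n.+3%:R^-1) n3 n0 => w w3 w0.
have w1 : w < 1 - w by lra.
have dFw (x : R) : w <= x <= 1 - w -> is_derive x 1 F (f x).
  by move=> x01; apply: dF; lra.
have cfw (x : R) : w <= x <= 1 - w -> {for x, continuous f}.
  by move=> x01; apply: cf; lra.
rewrite (integral_is_derive w1 dFw cfw).
rewrite lee_fin (le_trans (ler_norm _))// (le_trans (ler_normB _ _))//.
by rewrite lerD// FM//; lra.
Qed.

(** Multiplying the integrand by t + (1 - t) bounds it by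
    t^(a-1) + (1-t)^(b-1), whose primitive t^a / a - (1-t)^b / b is bounded. *)
Lemma integrable_beta {R : realType} (a b : R) : 0 < a -> 0 < b ->
  (@lebesgue_measure R).-integrable `]0, 1[
    (EFin \o (fun t => t `^ (a - 1) * (1 - t) `^ (b - 1))).
Proof.
move=> a0 b0.
pose h (t : R) := t `^ (a - 1) + (1 - t) `^ (b - 1).
have mp (c : R) : measurable_fun setT (fun t : R => t `^ c).
  exact: measurable_powR.
have mp1 (c : R) : measurable_fun setT (fun t : R => (1 - t) `^ c).
  by apply: (measurableT_comp (mp c)); exact: measurable_funB.
have powle1 (c t : R) : 0 < c -> 0 < t < 1 -> t `^ c <= 1.
  move=> c0 t01; rewrite -[leRHS](_ : 1 `^ c = 1); last by rewrite powR1.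
  by apply: ge0_ler_powR; rewrite ?nnegrE//; lra.
have ih : (@lebesgue_measure R).-integrable `]0, 1[ (EFin \o h).
  pose F (t : R) := a^-1 * t `^ a - b^-1 * (1 - t) `^ b.
  apply: (@integrable_bounded_primitive _ F h (a^-1 + b^-1)).
  + by move=> t _; rewrite addr_ge0// powR_ge0.
  + move=> t /andP[t0 t1]; have t1' : 0 < 1 - t by lra.
    have d1 := is_derive1_powR a t0.
    have d2 : is_derive t 1 (fun u : R => (1 - u) `^ b)
        (- (b * (1 - t) `^ (b - 1))).
      have d2 := is_derive1_powR b t1'.
      have d3 : is_derive t 1 (fun u : R => 1 - u) (- 1).
        by rewrite -[- 1]sub0r; exact: is_deriveB.
      have := @is_derive1_comp R (fun u : R => u `^ b) (fun u : R => 1 - u)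
        t _ _ d2 d3.
      by rewrite mulrN1.
    have -> : h t = a^-1 *: (a * t `^ (a - 1)) -
        b^-1 *: (- (b * (1 - t) `^ (b - 1))).
      rewrite /h /GRing.scale/= mulrN opprK !mulKf//; exact: lt0r_neq0.
    exact: is_deriveB.
  + move=> t /andP[t0 t1]; have t1' : 0 < 1 - t by lra.
    have cpow (c u : R) : 0 < u -> {for u, continuous (fun v : R => v `^ c)}.
      move=> u0; apply/differentiable_continuous/derivable1_diffP.
      by case: (is_derive1_powR c u0).
    apply: cvgD; first exact: cpow.
    apply: (@cvg_comp _ _ _ (fun u : R => 1 - u) (fun u : R => u `^ (b - 1))
        _ (nbhs (1 - t))).
      by apply: cvgB; [exact: cvg_cst|exact: cvg_id].
    exact: cpow.
  + move=> t t01; rewrite (le_trans (ler_normB _ _))//.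
    have aV : 0 < a^-1 by rewrite invr_gt0.
    have bV : 0 < b^-1 by rewrite invr_gt0.
    rewrite !ger0_norm ?mulr_ge0 ?powR_ge0 ?(ltW aV) ?(ltW bV)//.
    by rewrite lerD// ler_piMr ?(ltW aV) ?(ltW bV)// powle1//; lra.
apply: le_integrable ih => //.
- apply/measurable_EFinP; apply: measurable_funM.
    by apply: measurable_funTS; exact: mp.
  by apply: measurable_funTS; exact: mp1.
- move=> t /=; rewrite in_itv/= => t01; rewrite lee_fin.
  rewrite !ger0_norm ?mulr_ge0 ?addr_ge0 ?powR_ge0//.
  have -> : t `^ (a - 1) * (1 - t) `^ (b - 1) =
      t `^ (a - 1) * (1 - t) `^ b + t `^ a * (1 - t) `^ (b - 1).
    rewrite -(mulr_powRB1 _ b0); last by lra.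
    rewrite -(mulr_powRB1 _ a0); last by lra.
    by ring.
  by rewrite lerD// ?ler_piMr ?ler_piMl ?powR_ge0// powle1//; lra.
Qed.

(** * The product as a counting integral *)

(** The inverse of the map k -> rho (k^-p)^-2 on positive reals k, see
    [rho_threshold]; its integral against du/u is a beta integral. *)
Definition chi {R : realType} (p u : R) : R :=
  u `^ (1 / (2 * p)) * (1 - u) `^ (- (1 / p)).

Lemma chi_powR_div {R : realType} (p T theta u : R) : 0 <= T -> 0 < u < 1 ->
  (T * chi p u) `^ theta / u =
  T `^ theta *
  (u `^ (theta / (2 * p) - 1) * (1 - u) `^ (1 - theta / p - 1)).
Proof.
move=> T0 /andP[u0 u1]; have u1' : 0 < 1 - u by lra.
rewrite /chi !powRM ?mulr_ge0 ?powR_ge0// -!powRrM.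
have -> : 1 / (2 * p) * theta = theta / (2 * p) by ring.
have -> : 1 - theta / p - 1 = - (1 / p) * theta by ring.
rewrite powRB ?(gt_eqF u0) ?implybT// powRr1 ?ltW//; ring.
Qed.

(** With y = rho y - 1 / rho y, the difference of the two sides of the second
    inequality is that of rho y * v and 1, times a positive factor. *)
Lemma rho_inv_sqr_le {R : realType} (y v : R) : 0 <= y -> 0 < v ->
  (rho y ^- 2 <= v ^+ 2) = (1 - v ^+ 2 <= y * v).
Proof.
move=> y0 v0; have r1 := rho_ge1 y0; have rE := rho_sqr y.
have r0 : 0 < rho y by lra.
have -> : (rho y ^- 2 <= v ^+ 2) = (1 <= rho y * v).
  rewrite -[leLHS]mul1r ler_pdivrMr ?exprn_gt0// -exprMn mulrC.
  by rewrite -[X in X <= _](expr1n _ 2) ler_sqr ?nnegrE// mulr_ge0// ltW.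
have yE : y = rho y - (rho y)^-1.
  by apply: (@mulfI _ (rho y)); rewrite ?mulrBr ?divff; lra.
have E : (y * v - (1 - v ^+ 2)) * rho y = (rho y * v - 1) * (rho y + v).
  by rewrite {1}yE; field; lra.
apply/idP/idP => H; rewrite -subr_ge0.
- rewrite -(pmulr_lge0 _ r0) E mulr_ge0//; lra.
- have rv : 0 < rho y + v by lra.
  by rewrite -(pmulr_lge0 _ rv) -E mulr_ge0//; lra.
Qed.

Lemma rho_threshold {R : realType} (p T k u : R) :
  0 < p -> 0 < T -> 0 < k -> 0 < u < 1 ->
  (rho (T `^ p * k `^ (- p)) ^- 2 <= u) = (k <= T * chi p u).
Proof.
move=> p0 T0 k0 /andP[u0 u1]; have u1' : 0 < 1 - u by lra.
pose v := u `^ (1 / 2).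
have v0 : 0 < v by exact: powR_gt0.
have vE : v ^+ 2 = u.
  rewrite -powR_mulrn ?(ltW v0)// -powRrM.
  by rewrite (_ : 1 / 2 * 2%:R = 1) ?powRr1 ?(ltW u0)//; field.
rewrite -{1}vE rho_inv_sqr_le ?mulr_ge0 ?powR_ge0// vE.
have chi0 : 0 < chi p u by rewrite mulr_gt0// powR_gt0.
have chiE : chi p u `^ p = v / (1 - u).
  rewrite /chi powRM ?powR_ge0// -!powRrM.
  have -> : 1 / (2 * p) * p = 1 / 2 by field; lra.
  have -> : - (1 / p) * p = -1 by field; lra.
  by rewrite powR_inv1// ltW.
have mono : {in Num.nneg &, {mono (fun x : R => x `^ p) : x y / x <= y}}.
  by apply: le_mono_in; exact: gt0_ltr_powR.
rewrite -(mono k (T * chi p u)) ?nnegrE ?(ltW k0) ?(ltW (mulr_gt0 T0 chi0))//.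
rewrite powRM ?(ltW T0) ?(ltW chi0)// chiE powRN mulrA ler_pdivlMr//.
rewrite mulrAC ler_pdivlMr ?powR_gt0//.
by rewrite mulrC.
Qed.

Definition count_le {R : realType} (N : nat) (z : R) : R :=
  \sum_(j < N) (j.+1%:R <= z)%R%:R.

Lemma count_leS {R : realType} N (z : R) :
  count_le N.+1 z = count_le N z + (N.+1%:R <= z)%R%:R.
Proof. by rewrite /count_le big_ord_recr. Qed.

Lemma count_le_full {R : realType} N (z : R) : N%:R <= z -> count_le N z = N%:R.
Proof.
move=> Nz; rewrite /count_le (eq_bigr (fun=> 1)) => [|j _].
  by rewrite sumr_const card_ord.
by rewrite (le_trans _ Nz)// ler_nat.
Qed.

Lemma count_le_ge0 {R : realType} N (z : R) : 0 <= count_le N z.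
Proof. by apply: sumr_ge0. Qed.

Lemma count_le_le {R : realType} N (z : R) : 0 <= z -> count_le N z <= z.
Proof.
move=> z0; elim: N => [|N IHN]; first by rewrite /count_le big_ord0.
have [Nz|zN] := leP N.+1%:R z; first by rewrite count_le_full.
by rewrite count_leS (lt_geF zN) addr0.
Qed.

Lemma count_le_ge {R : realType} N (z : R) : z < N%:R -> z - 1 <= count_le N z.
Proof.
elim: N => [|N IHN] zN; first by rewrite /count_le big_ord0; lra.
rewrite count_leS (lt_geF zN) addr0.
have [/IHN//|Nz] := ltP z N%:R.
by rewrite count_le_full//; move: zN; rewrite -natr1; lra.
Qed.

(** [count_le N z] is the minimum of N and the integer part of z.  The square
    root absorbs the rounding error, the last term the truncation at N; they
    are chosen as powers of z because powers of [chi] integrate to beta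
    values. *)
Lemma count_le_approx {R : realType} N (z q : R) :
  0 <= z -> 1 < q -> (0 < N)%N ->
  z - z `^ (1 / 2) - N%:R `^ (1 - q) * z `^ q <= count_le N z.
Proof.
move=> z0 q1 N0; have N0' : 0 < N%:R :> R by rewrite ltr0n.
have sq0 := powR_ge0 z (1 / 2); have q0 := powR_ge0 z q.
have Nq0 : 0 < N%:R `^ (1 - q) :> R by exact: powR_gt0.
have zq : 0 <= N%:R `^ (1 - q) * z `^ q by rewrite mulr_ge0// ltW.
have [zN|Nz] := ltP z N%:R; last first.
  apply: le_trans (count_le_ge0 N z); rewrite subr_le0 (@le_trans _ _ z)//.
    by rewrite lerBlDr lerDl.
  have zp : 0 < z by exact: lt_le_trans Nz.
  (* The truncation error alone exceeds z, because 1 - q < 0 and N <= z. *)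
  have zE : z = z `^ (1 - q) * z `^ q.
    by rewrite -powRD ?subrK ?powRr1// (gt_eqF zp) implybT.
  rewrite [leLHS]zE ler_wpM2r// -opprB !powRN lef_pV2 ?posrE ?powR_gt0//.
  by apply: ge0_ler_powR; rewrite ?nnegrE//; lra.
have [z1|z1] := leP 1 z.
  apply: le_trans (count_le_ge zN).
  have : 1 <= z `^ (1 / 2) by rewrite -[leLHS](powRr0 z) ler_powR//; lra.
  lra.
apply: le_trans (count_le_ge0 N z).
have [zz|zn0] := eqVneq z 0; first by lra.
have : z <= z `^ (1 / 2).
  by apply: ger1_powR; [rewrite lt0r zn0 z0 (ltW z1)|lra].
lra.
Qed.

Lemma ln_rho_integral {R : realType} (y : R) : 0 < y ->
  (@lebesgue_measure R).-integrable `]0, 1[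
    (EFin \o (fun u => (rho y ^- 2 <= u)%R%:R / u)) /\
  ln (rho y ^+ 2) =
  \int[@lebesgue_measure R]_(u in `]0, 1[) ((rho y ^- 2 <= u)%R%:R / u).
Proof.
move=> y0; set c := rho y ^- 2.
have r1 : 1 < rho y.
  have := rho_ge1 (ltW y0); rewrite le_eqVlt => /orP[/eqP r1|//].
  by have := rho_sqr y; rewrite -r1; lra.
have c0 : 0 < c by rewrite invr_gt0 exprn_gt0//; lra.
have c1 : c < 1.
  rewrite invf_lt1 ?exprn_gt0//; last by lra.
  by rewrite exprn_egt1.
have dln (x : R) : c <= x <= 1 -> is_derive x 1 (@ln R) x^-1.
  by move=> /andP[cx _]; apply: is_derive1_ln; lra.
have cln (x : R) : c <= x <= 1 -> {for x, continuous (fun u : R => u^-1)}.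
  by move=> /andP[cx _]; apply: inv_continuous; lra.
have iV : (@lebesgue_measure R).-integrable `[c, 1]
    (EFin \o (fun u : R => u^-1)).
  apply: continuous_compact_integrable; first exact: segment_compact.
  by apply: continuous_in_subspaceT => x; rewrite inE/= in_itv/=; exact: cln.
have iV' : (@lebesgue_measure R).-integrable `[c, 1[
    (EFin \o (fun u : R => u^-1)).
  apply: (integrableS _ _ _ iV) => // x /=.
  by rewrite !in_itv/= => /andP[-> /ltW ->].
have cE : `]0, 1[ `&` [set u | c <= u] = `[c, 1[%classic :> set R.
  apply/seteqP; split=> u /=; rewrite !in_itv/=.
    by move=> [/andP[_ ->] ->].
  by move=> /andP[cu ->]; rewrite cu (lt_le_trans c0 cu).
have fE : (fun u => (c <= u)%R%:R / u) =
    ((fun u : R => u^-1) \_ [set u | c <= u]).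
  apply/funext => u; rewrite patchE; case: ifPn; rewrite ?inE/= ?notin_setE/=.
    by move=> ->; rewrite mul1r.
  by move=> /negP/negbTE ->; rewrite mul0r.
rewrite fE; split.
  have mc : measurable [set u : R | c <= u].
    rewrite (_ : [set _ | _] = `[c, +oo[%classic); first exact: measurable_itv.
    by apply/seteqP; split=> u /=; rewrite in_itv/= andbT.
  rewrite -restrict_EFin; apply/integrable_restrict => //.
  by rewrite cE.
rewrite -Rintegral_mkcondr cE Rintegral_itv_bndo_bndc//.
rewrite /Rintegral (integral_is_derive c1 dln cln)/= ln1 sub0r /c lnV ?opprK//.
by rewrite posrE exprn_gt0//; lra.
Qed.

(** * Logarithm of the product against the beta integral *)

(** The integral of [chi p] to the power theta against du/u. *)
Definition beta_at {R : realType} (p theta : R) : R :=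
  euler_beta (theta / (2 * p)) (1 - theta / p).

Lemma ln_rho_prod_integral {R : realType} (p T : R) N : 0 < p -> 0 < T ->
  (@lebesgue_measure R).-integrable `]0, 1[
    (EFin \o (fun u => count_le N (T * chi p u) / u)) /\
  ln (rho_prod (zeta_term p) (T `^ p) N) =
  \int[@lebesgue_measure R]_(u in `]0, 1[) (count_le N (T * chi p u) / u).
Proof.
move=> p0 T0.
have m01 : measurable (`]0, 1[%classic : set (measurableTypeR R)).
  exact: measurable_itv.
elim: N => [|N [IHi IHe]].
  have c0 : (fun u => count_le 0 (T * chi p u) / u) = cst 0.
    by apply/funext => u; rewrite /count_le big_ord0 mul0r.
  rewrite c0 /rho_prod big_ord0 ln1; split; first exact: integrable0.
  by rewrite Rintegral_cst// mul0r.
set y := T `^ p * N.+1%:R `^ (- p).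
have y0 : 0 < y by rewrite mulr_gt0 ?powR_gt0// ltr0n.
have [Ii Ie] := ln_rho_integral y0.
have cE u : 0 < u < 1 -> count_le N.+1 (T * chi p u) / u =
    count_le N (T * chi p u) / u + (rho y ^- 2 <= u)%R%:R / u.
  by move=> u01; rewrite count_leS mulrDl rho_threshold// ltr0n.
have E : {in `]0, 1[%classic, (fun u => count_le N (T * chi p u) / u +
    (rho y ^- 2 <= u)%R%:R / u) =1 (fun u => count_le N.+1 (T * chi p u) / u)}.
  by move=> u; rewrite inE/= in_itv/= => /cE ->.
split.
  apply: (eq_integrable m01 _ _ _ (integrableD m01 IHi Ii)).
  by move=> u /E /= <-.
apply: (@eq_trans _ _ (\int[@lebesgue_measure R]_(u in `]0, 1[)
  (count_le N (T * chi p u) / u + (rho y ^- 2 <= u)%R%:R / u))); last first.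
  exact: eq_Rintegral.
rewrite RintegralD// -IHe -Ie /rho_prod big_ord_recr/= lnM//.
  rewrite posrE; apply: prodr_gt0 => j _; rewrite exprn_gt0//.
  by rewrite (lt_le_trans ltr01)// rho_ge1// mulr_ge0// powR_ge0.
by rewrite posrE exprn_gt0// (lt_le_trans _ (rho_ge1 (ltW y0))).
Qed.

Lemma integral_chi {R : realType} (p T theta : R) :
  0 < T -> 0 < theta < p ->
  (@lebesgue_measure R).-integrable `]0, 1[
    (EFin \o (fun u => (T * chi p u) `^ theta / u)) /\
  \int[@lebesgue_measure R]_(u in `]0, 1[) ((T * chi p u) `^ theta / u) =
  T `^ theta * beta_at p theta.
Proof.
move=> T0 /andP[th0 thp]; have p0 : 0 < p by lra.
have m01 : measurable (`]0, 1[%classic : set (measurableTypeR R)).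
  exact: measurable_itv.
have E : {in `]0, 1[%classic, (fun u => T `^ theta *
    (u `^ (theta / (2 * p) - 1) * (1 - u) `^ (1 - theta / p - 1))) =1
    (fun u => (T * chi p u) `^ theta / u)}.
  by move=> u; rewrite inE/= in_itv/= => u01; rewrite chi_powR_div// ltW.
have Ib : (@lebesgue_measure R).-integrable `]0, 1[ (EFin \o
    (fun u => u `^ (theta / (2 * p) - 1) * (1 - u) `^ (1 - theta / p - 1))).
  apply: integrable_beta; first by rewrite divr_gt0// mulr_gt0.
  by rewrite subr_gt0 ltr_pdivrMr// mul1r.
split; last first.
  by rewrite -RintegralZl//; apply/esym; exact: eq_Rintegral.
apply: (eq_integrable m01 _ _ _ (integrableZl m01 (T `^ theta) Ib)).
by move=> u /E /= <-.
Qed.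

Lemma ln_rho_prod_le {R : realType} (p T : R) N : 1 < p -> 0 < T ->
  ln (rho_prod (zeta_term p) (T `^ p) N) <= T * beta_at p 1.
Proof.
move=> p1 T0; have p0 : 0 < p by lra.
have [Ci ->] := ln_rho_prod_integral N p0 T0.
have [Ki Ke] : _ /\ _ := @integral_chi _ p T 1 T0 ltac:(lra).
rewrite -{2}(powRr1 (ltW T0)) -Ke; apply: le_Rintegral => //.
move=> u /=; rewrite in_itv/= => /andP[u0 u1].
have chi0 : 0 <= T * chi p u by rewrite mulr_ge0 ?mulr_ge0 ?powR_ge0// ltW.
by rewrite powRr1// ler_pM2r ?invr_gt0// count_le_le.
Qed.

Lemma ln_rho_prod_ge {R : realType} (p T q : R) N :
  1 < q < p -> 0 < T -> (0 < N)%N ->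
  T * beta_at p 1 - T `^ (1 / 2) * beta_at p (1 / 2) -
    N%:R `^ (1 - q) * (T `^ q * beta_at p q) <=
  ln (rho_prod (zeta_term p) (T `^ p) N).
Proof.
move=> /andP[q1 qp] T0 N0; have p0 : 0 < p by lra.
have m01 : measurable (`]0, 1[%classic : set (measurableTypeR R)).
  exact: measurable_itv.
have [Ci ->] := ln_rho_prod_integral N p0 T0.
have [K1i K1e] : _ /\ _ := @integral_chi _ p T 1 T0 ltac:(lra).
have [K2i K2e] : _ /\ _ := @integral_chi _ p T (1 / 2) T0 ltac:(lra).
have [Kqi Kqe] : _ /\ _ := @integral_chi _ p T q T0 ltac:(lra).
rewrite -{1}(powRr1 (ltW T0)) -K1e -K2e -Kqe -RintegralZl//.
have Kqi' := integrableZl m01 (N%:R `^ (1 - q)) Kqi.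
have K12i := integrableB m01 K1i K2i.
rewrite -RintegralB// -RintegralB//; apply: le_Rintegral => //.
  exact: (integrableB m01 K12i Kqi').
move=> u /=; rewrite in_itv/= => /andP[u0 u1].
have chi0 : 0 <= T * chi p u by rewrite mulr_ge0 ?mulr_ge0 ?powR_ge0// ltW.
rewrite powRr1// mulrA -!mulrBl ler_pM2r ?invr_gt0//.
exact: count_le_approx.
Qed.

(** * Extracting a coefficient *)

Lemma zeta_term_ge0 {R : realType} (p : R) j : 0 <= zeta_term p j.
Proof. exact: powR_ge0. Qed.

Lemma zeta_term_dec {R : realType} (p : R) j : 0 < p ->
  zeta_term p j.+2 <= zeta_term p j.+1.
Proof.
move=> p0; rewrite /zeta_term !powRN lef_pV2 ?posrE ?powR_gt0 ?ltr0n//.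
by apply: ge0_ler_powR; rewrite ?nnegrE ?ler_nat// ltW.
Qed.

Lemma rho_prod_gt0 {R : realType} (p T : R) N :
  0 < rho_prod (zeta_term p) (T `^ p) N.
Proof.
apply: prodr_gt0 => j _; rewrite exprn_gt0//.
by rewrite (lt_le_trans ltr01)// rho_ge1// mulr_ge0// powR_ge0.
Qed.

Lemma beta_at_ge0 {R : realType} (p theta : R) : 0 <= beta_at p theta.
Proof. by apply: Rintegral_ge0 => u _; rewrite mulr_ge0// powR_ge0. Qed.

(** A consequence of the upper bound at T = N = 1, whose left-hand side is
    ln (rho 1 ^ 2). *)
Lemma beta_at1_gt0 {R : realType} (p : R) : 1 < p -> 0 < beta_at p 1.
Proof.
move=> p1; have := ln_rho_prod_le 1 p1 (@ltr01 R); rewrite mul1r.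
apply: lt_le_trans; rewrite ln_gt0// /rho_prod big_ord_recl big_ord0 mulr1.
rewrite /zeta_term !powR1 mulr1.
have r1 := rho_ge1 (@ler01 R); have := rho_sqr (1 : R); nra.
Qed.

Lemma gen_fun_le_expR {R : realType} (p T : R) K N : 1 < p -> 0 < T ->
  \sum_(0 <= m < K) trunc_sum (zeta_term p) m N * (T `^ p) ^+ m <=
  2 * expR (T * beta_at p 1).
Proof.
move=> p1 T0; have p0 : 0 < p by lra.
rewrite big_mkord (le_trans (sum_trunc_le K N (zeta_term_ge0 p) _ _))//.
- by move=> j; exact: zeta_term_dec.
- exact: powR_ge0.
- rewrite ler_pM2l// -[leLHS]lnK ?posrE ?rho_prod_gt0// ler_expR.
  exact: ln_rho_prod_le.
Qed.

Lemma gen_fun_ge_expR {R : realType} (p T : R) : 1 < p -> 0 < T ->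
  exists N, forall K, (N.*2.+1 < K)%N ->
    expR (T * beta_at p 1 - T `^ (1 / 2) * beta_at p (1 / 2) - 1) <=
    \sum_(0 <= m < K) trunc_sum (zeta_term p) m N * (T `^ p) ^+ m.
Proof.
move=> p1 T0; have p0 : 0 < p by lra.
(* Any q strictly between 1 and p works: q > 1 makes the truncation error
   vanish as N grows, q < p makes beta_at p q a convergent integral. *)
pose q := (1 + p) / 2.
have q1p : 1 < q < p by rewrite /q; apply/andP; split; lra.
have q1 : 0 < q - 1 by case/andP: q1p; lra.
set b := T `^ q * beta_at p q.
have b0 : 0 <= b by rewrite mulr_ge0 ?powR_ge0 ?beta_at_ge0.
pose N := (Num.bound (b `^ (q - 1)^-1)).+1; exists N => K NK.
have Nb : N%:R `^ (1 - q) * b <= 1.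
  rewrite -opprB powRN mulrC ler_pdivrMr ?powR_gt0 ?ltr0n// mul1r.
  have -> : b = (b `^ (q - 1)^-1) `^ (q - 1).
    by rewrite -powRrM mulVf ?powRr1// gt_eqF.
  apply: ge0_ler_powR; rewrite ?nnegrE ?powR_ge0 ?(ltW q1)//.
  rewrite (le_trans (ltW (archi_boundP (powR_ge0 _ _))))// ler_nat.
  exact: leqnSn.
rewrite big_mkord; apply: le_trans (sum_trunc_ge (zeta_term_ge0 p) _ _ NK).
- rewrite -[leRHS]lnK ?posrE ?rho_prod_gt0// ler_expR.
  apply: le_trans (ln_rho_prod_ge q1p T0 (ltn0Sn _)).
  by rewrite lerD2l lerN2.
- by move=> j; exact: zeta_term_dec.
- exact: powR_ge0.
Qed.

(** Exponential change of measure: replacing T by T s multiplies the m-th term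
    by s^(pm), which is at least s^(pL) on the range of summation.  A tail
    above L is bounded with s > 1 and a tail below L with s < 1. *)
Lemma chernoff {R : realType} (p T s L : R) (i K N : nat) :
  1 < p -> 0 < T -> 0 < s ->
  (forall m, (i <= m < K)%N -> L * ln s <= m%:R * ln s) ->
  \sum_(i <= m < K) trunc_sum (zeta_term p) m N * (T `^ p) ^+ m <=
  2 * expR (T * s * beta_at p 1 - p * L * ln s).
Proof.
move=> p1 T0 s0 Lm; have p0 : 0 < p by lra.
have Ts0 : 0 < T * s by exact: mulr_gt0.
rewrite expRD mulrA.
apply: (@le_trans _ _ ((\sum_(0 <= m < K) trunc_sum (zeta_term p) m N *
    ((T * s) `^ p) ^+ m) * expR (- (p * L * ln s)))); last first.
  by rewrite ler_pM2r ?expR_gt0// gen_fun_le_expR.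
have t0 m : 0 <= trunc_sum (zeta_term p) m N * ((T * s) `^ p) ^+ m.
  rewrite mulr_ge0 ?exprn_ge0 ?powR_ge0 ?trunc_sum_ge0//.
  exact: zeta_term_ge0.
have [iK|Ki] := leqP i K; last first.
  by rewrite big_geq ?(ltnW Ki)// mulr_ge0 ?expR_ge0// sumr_ge0.
apply: (@le_trans _ _ ((\sum_(i <= m < K) trunc_sum (zeta_term p) m N *
    ((T * s) `^ p) ^+ m) * expR (- (p * L * ln s)))); last first.
  rewrite ler_pM2r ?expR_gt0// [leRHS](big_cat_nat (leq0n i) iK)//=.
  by rewrite lerDr sumr_ge0.
rewrite mulr_suml big_nat [leRHS]big_nat; apply: ler_sum => m im.
rewrite -mulrA ler_wpM2l ?trunc_sum_ge0//; first exact: zeta_term_ge0.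
rewrite powRM ?(ltW T0) ?(ltW s0)// exprMn -(mulrA (_ ^+ m)) ler_peMr//.
  by rewrite exprn_ge0// powR_ge0.
have -> : (s `^ p) ^+ m = expR (p * (m%:R * ln s)).
  by rewrite /powR (gt_eqF s0) -expRM_natl mulrCA.
rewrite -expRD -[leLHS]expR0 ler_expR subr_ge0 -[leLHS]mulrA ler_pM2l//.
exact: Lm.
Qed.

Lemma trunc_sum_le_expR {R : realType} (p T : R) n N : 1 < p -> 0 < T ->
  trunc_sum (zeta_term p) n N <=
  expR (1 + T * beta_at p 1 - p * n%:R * ln T).
Proof.
move=> p1 T0; have p0 : 0 < p by lra.
have := @chernoff _ p 1 T n%:R n n.+1 N p1 ltr01 T0.
rewrite big_nat1 powR1 expr1n mulr1 mul1r.
move=> /(_ _)/le_trans; apply.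
  by move=> m; rewrite ltnS => /anti_leq ->.
rewrite -addrA [leRHS]expRD ler_pM2r ?expR_gt0//.
by have := @expR_ge1Dx R 1; lra.
Qed.

Lemma sum_zeta_bounded {R : realType} (p : R) : 1 < p ->
  exists2 Z : R, 1 <= Z & forall M, \sum_(j < M) zeta_term p j.+1 <= Z.
Proof.
move=> p1; exists (1 + 2 * expR (beta_at p 1)).
  by rewrite lerDl mulr_ge0 ?expR_ge0.
move=> M; rewrite (le_trans _ (_ : 2 * expR (beta_at p 1) <= _))//; last lra.
have := gen_fun_le_expR 2 M p1 (@ltr01 R).
rewrite big_nat_recr//= big_nat1 powR1 !expr1n !mulr1 mul1r trunc_sum0.
have -> : trunc_sum (zeta_term p) 1 M = \sum_(j < M) zeta_term p j.+1.
  by rewrite trunc_sumS; apply: eq_bigr => j _; rewrite trunc_sum0 mulr1.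
lra.
Qed.

(** The exponents met in the two tails when s is 1 - x / 2 or 1 + x / 2 and the
    tail starts at relative distance x from the mean, with ln s replaced by
    1 - 1 / s. *)
Lemma tail_exponent_lower {R : realFieldType} (x : R) : 0 < x <= 1 / 2 ->
  (1 - x / 2) + (1 - x) * ((1 - x / 2)^-1 - 1) <= 1 - x ^+ 2 / 6.
Proof.
move=> /andP[x0 x1]; have h0 : 0 < 1 - x / 2 by lra.
have -> : (1 - x / 2) + (1 - x) * ((1 - x / 2)^-1 - 1) =
    1 - x ^+ 2 / 4 / (1 - x / 2) by field; lra.
rewrite lerD2l lerN2 ler_pdivlMr//; nra.
Qed.

Lemma tail_exponent_upper {R : realFieldType} (x : R) : 0 < x <= 1 / 2 ->
  (1 + x / 2) - (1 + x) * (1 - (1 + x / 2)^-1) <= 1 - x ^+ 2 / 6.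
Proof.
move=> /andP[x0 x1]; have h0 : 0 < 1 + x / 2 by lra.
have -> : (1 + x / 2) - (1 + x) * (1 - (1 + x / 2)^-1) =
    1 - x ^+ 2 / 4 / (1 + x / 2) by field; lra.
rewrite lerD2l lerN2 ler_pdivlMr//; nra.
Qed.

Lemma ln_le_subr1 {R : realType} (s : R) : 0 < s -> ln s <= s - 1.
Proof.
move=> s0; have := @le_ln1Dx R (s - 1); rewrite (addrC 1) subrK; apply; lra.
Qed.

Lemma ln_ge_1subrV {R : realType} (s : R) : 0 < s -> 1 - s^-1 <= ln s.
Proof.
move=> s0; have := @ln_le_subr1 R s^-1.
rewrite invr_gt0 lnV ?posrE// => /(_ s0).
lra.
Qed.

(** At T = p c / A the terms of the generating function concentrate around
    m = c.  The two tails m < (1 - x) c = n and m >= (1 + x) c take up at most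
    half of the sum, so the window n <= m < n + d, d about 2 x c, carries the
    other half; and every coefficient in this window is at most Z^d times the
    one at n. *)
Lemma trunc_sum_ge_expR {R : realType} (p Z x c : R) (n : nat) :
  1 < p -> 1 <= Z -> (forall M, \sum_(j < M) zeta_term p j.+1 <= Z) ->
  0 < x <= 1 / 2 -> 0 < c -> n%:R = (1 - x) * c ->
  let T := p * c / beta_at p 1 in
  1 <= T ->
  T `^ (1 / 2) * beta_at p (1 / 2) + 4 <= p * c * x ^+ 2 / 6 ->
  exists N, expR (p * c - T `^ (1 / 2) * beta_at p (1 / 2) - 3 -
      (2 * x * c + 1) * (1 + ln Z) - p * (n%:R + (2 * x * c + 1)) * ln T) <=
    trunc_sum (zeta_term p) n N.
Proof.
move=> p1 Z1 Zsum x01 c0 nE T T1 Tx; have p0 : 0 < p by lra.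
have [x0 x1] : 0 < x /\ x <= 1 / 2 by move: x01 => /andP[].
have A0 := beta_at1_gt0 p1; have T0 : 0 < T by lra.
have TA : T * beta_at p 1 = p * c by rewrite /T mulfVK// gt_eqF.
have [N gN] := gen_fun_ge_expR p1 T0; exists N.
rewrite TA in gN; set V := T `^ (1 / 2) * _ in Tx gN *.
pose d := (Num.truncn (2 * x * c)).+1.
have xc0 : 0 < 2 * x * c by rewrite mulr_gt0// mulr_gt0.
have [d_gt d_le] : 2 * x * c < d%:R /\ d%:R <= 2 * x * c + 1.
  have := truncn_itv (ltW xc0) => /andP[dl dg]; split=> //.
  by rewrite /d -natr1 lerD2r.
pose K := (n + d + N.*2.+2)%N.
have := gN K (leq_addl _ _); rewrite /K.
rewrite (@big_cat_nat _ _ _ (n + d)) ?leq_addr//=.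
rewrite (@big_cat_nat _ _ _ n) ?leq_addr//=.
set S1 := \sum_(0 <= _ < n) _; set S2 := \sum_(n <= _ < n + d) _.
set S3 := \sum_(n + d <= _ < _) _ => gS.
set e := expR (p * c - V - 1) in gS.
have e0 : 0 < e := expR_gt0 _.
(* Each tail is at most a quarter of the lower bound e of the whole sum. *)
have tail : 2 * expR (p * c * (1 - x ^+ 2 / 6)) <= e / 4.
  have e3 : 8 <= expR 3 :> R.
    have := @expR_ge1Dx R 1; rewrite -[3]mulr1 expRM_natl => ?.
    have -> : 8 = (1 + 1) ^+ 3 :> R by ring.
    by rewrite lerXn2r ?nnegrE ?expR_ge0//; lra.
  rewrite ler_pdivlMr//.
  rewrite (_ : 2 * _ * 4 = 8 * expR (p * c * (1 - x ^+ 2 / 6))); last by ring.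
  apply: (@le_trans _ _ (expR 3 * expR (p * c * (1 - x ^+ 2 / 6)))).
    by rewrite ler_pM2r ?expR_gt0.
  by rewrite -expRD ler_expR; lra.
have S1le : S1 <= e / 4.
  apply: le_trans tail; rewrite /S1.
  apply: le_trans (@chernoff _ p T (1 - x / 2) n%:R _ _ _ p1 T0 _ _) _.
  - lra.
  - move=> m /andP[_ mn]; rewrite ler_wnM2r ?ler_nat ?(ltnW mn)//.
    by rewrite ln_le0//; lra.
  rewrite ler_pM2l// ler_expR mulrAC TA nE.
  have s0 : 0 < 1 - x / 2 by lra.
  have := tail_exponent_lower x01; have := ln_ge_1subrV s0.
  set l := ln _; set v := _^-1 => lv h.
  have pc0 : 0 < p * c by exact: mulr_gt0.
  have -> : p * c * (1 - x / 2) - p * ((1 - x) * c) * l =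
    p * c * ((1 - x / 2) - (1 - x) * l) by ring.
  rewrite ler_pM2l//; apply: le_trans h; rewrite lerD2l -mulrN ler_pM2l; lra.
have S3le : S3 <= e / 4.
  apply: le_trans tail; rewrite /S3.
  apply: le_trans (@chernoff _ p T (1 + x / 2) ((1 + x) * c) _ _ _ p1 T0 _ _) _.
  - lra.
  - move=> m /andP[mn _]; rewrite ler_wpM2r ?ln_ge0//; first lra.
    apply: (@le_trans _ _ (n + d)%:R); last by rewrite ler_nat.
    by rewrite natrD nE; lra.
  rewrite ler_pM2l// ler_expR mulrAC TA.
  have s0 : 0 < 1 + x / 2 by lra.
  have := tail_exponent_upper x01; have := ln_ge_1subrV s0.
  set l := ln _; set v := _^-1 => lv h.
  have pc0 : 0 < p * c by exact: mulr_gt0.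
  have -> : p * c * (1 + x / 2) - p * ((1 + x) * c) * l =
    p * c * ((1 + x / 2) - (1 + x) * l) by ring.
  rewrite ler_pM2l//; apply: le_trans h; rewrite lerD2l lerN2 ler_pM2l; lra.
have S2ge : e / 2 <= S2 by lra.
set t := T `^ p in S1 S2 S3 gS S1le S2ge S3le *.
have t1 : 1 <= t by rewrite /t -[leLHS](powRr0 T) ler_powR// ltW.
have en0 : 0 <= trunc_sum (zeta_term p) n N.
  exact/trunc_sum_ge0/zeta_term_ge0.
have S2le :
    S2 <= d%:R * (trunc_sum (zeta_term p) n N * (Z ^+ d * t ^+ (n + d))).
  rewrite /S2 mulr_natl -[X in _ *+ X](addKn n) -sumr_const_nat.
  rewrite big_nat [leRHS]big_nat; apply: ler_sum => m /andP[nm md].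
  rewrite mulrA; apply: ler_pM.
  - exact/trunc_sum_ge0/zeta_term_ge0.
  - by rewrite exprn_ge0// (le_trans ler01).
  - rewrite -(subnKC nm).
    apply: le_trans (trunc_sum_le_geometric _ _ _ (zeta_term_ge0 p) Zsum) _.
    by rewrite ler_wpM2l// ler_weXn2l// leq_subLR ltnW.
  - by rewrite ler_weXn2l// ltnW.
have Z0 : 0 < Z by lra.
have tn : t ^+ (n + d) = expR (p * (n + d)%:R * ln T).
  by rewrite /t /powR (gt_eqF T0) -expRM_natl; congr expR; ring.
have Zd : Z ^+ d = expR (d%:R * ln Z) by rewrite expRM_natl lnK ?posrE.
have de : d%:R <= expR d%:R :> R by have := expR_ge1Dx (d%:R : R); lra.
have eh : expR (p * c - V - 2) <= e / 2.
  have e1 : 2 <= expR 1 :> R by have := @expR_ge1Dx R 1; lra.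
  rewrite ler_pdivlMr// /e.
  have -> : p * c - V - 1 = (p * c - V - 2) + 1 by ring.
  by rewrite [leRHS]expRD ler_pM2l ?expR_gt0.
have H : expR (p * c - V - 2) <= trunc_sum (zeta_term p) n N *
    expR (d%:R + d%:R * ln Z + p * (n + d)%:R * ln T).
  apply: (le_trans eh); apply: (le_trans S2ge); apply: (le_trans S2le).
  rewrite Zd tn mulrCA -expRD ler_wpM2l// -addrA [leRHS]expRD.
  by rewrite ler_pM2r ?expR_gt0.
rewrite -(ler_pM2r (expR_gt0 (d%:R + d%:R * ln Z + p * (n + d)%:R * ln T))).
apply: le_trans H; rewrite -expRD ler_expR natrD.
have lnZ0 : 0 <= ln Z by exact: ln_ge0.
have lnT0 : 0 <= ln T by exact: ln_ge0.
have h1 : 0 <= (2 * x * c + 1 - d%:R) * (1 + ln Z) by rewrite mulr_ge0//; lra.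
have h2 : 0 <= (2 * x * c + 1 - d%:R) * (p * ln T).
  by rewrite mulr_ge0 ?mulr_ge0//; lra.
lra.
Qed.

(** * Asymptotics of the two bounds *)

Lemma k_between {R : realType} (p E F : R) (n : nat) : 1 < p -> (0 < n)%N ->
  (exists N, expR E <= trunc_sum (zeta_term p) n N) ->
  (forall N, trunc_sum (zeta_term p) n N <= expR F) ->
  ((expR (ln n%:R + E / (n%:R * p)))%:E <= k p n <=
   (expR (ln n%:R + F / (n%:R * p)))%:E)%E.
Proof.
move=> p1 n0 [N EN] tF; have p0 : 0 < p by lra.
have n0' : 0 < n%:R :> R by rewrite ltr0n.
have sE : ((expR E)%:E <= s p n)%E.
  by apply: le_trans (trunc_sum_le_s p n N); rewrite lee_fin.
have sF := s_le tF.
have r0 : 0 <= 1 / (n%:R * p) by rewrite divr_ge0// mulr_ge0// ltW.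
have ER (G : R) : (expR (ln n%:R + G / (n%:R * p)))%:E =
    (n%:R%:E * (expR G)%:E `^ (1 / (n%:R * p)))%E.
  by rewrite expRD lnK// poweR_EFin -expRM mul1r.
have s0 : (0 <= s p n)%E by apply: le_trans sE; rewrite lee_fin expR_ge0.
have sI : s p n \in `[0%E, +oo%E] by rewrite in_itv/= s0 leey.
have eI (G : R) : (expR G)%:E \in `[0%E, +oo%E].
  by rewrite in_itv/= lee_fin expR_ge0 leey.
have nE0 : (0 <= n%:R%:E :> \bar R)%E by rewrite lee_fin ltW.
have hE := gt0_ler_poweR r0 (eI E) sI sE.
have hF := gt0_ler_poweR r0 sI (eI F) sF.
rewrite (ER E) (ER F); apply/andP; split.
- exact: lee_wpmul2l nE0 _ _ hE.
- exact: lee_wpmul2l nE0 _ _ hF.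
Qed.

(** T = p n / A minimizes exp (A T) T^(-pn). *)
Lemma trunc_sum_le_optimal {R : realType} (p : R) (n : nat) :
  1 < p -> (0 < n)%N -> forall N, trunc_sum (zeta_term p) n N <=
  expR (1 + p * n%:R - p * n%:R * ln (p * n%:R / beta_at p 1)).
Proof.
move=> p1 n0 N; have A0 := beta_at1_gt0 p1.
have n0' : 0 < n%:R :> R by rewrite ltr0n.
have T0 : 0 < p * n%:R / beta_at p 1 by rewrite divr_gt0// mulr_gt0//; lra.
have := trunc_sum_le_expR n N p1 T0.
by rewrite divfK// gt_eqF.
Qed.

(** In [trunc_sum_ge_expR], take x = n^(-1/8).  The sixteenth root w of n makes
    every quantity polynomial in w: the gain p c x^2 is of order w^12, while
    sqrt T is of order w^8 and the loss x n ln T is below the order n / w. *)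
Lemma trunc_sum_ge_optimal {R : realType} (p : R) : 1 < p ->
  exists D W : R, forall (n : nat) (w : R), n%:R = w ^+ 16 -> W <= w ->
  exists N, expR (p * n%:R * (1 + ln (beta_at p 1 / p) - ln n%:R - D / w)) <=
    trunc_sum (zeta_term p) n N.
Proof.
move=> p1; have p0 : 0 < p by lra.
have [Z Z1 Zsum] := sum_zeta_bounded p1.
have H x c n := @trunc_sum_ge_expR _ p Z x c n p1 Z1 Zsum.
have A0 := beta_at1_gt0 p1; have b0 := beta_at_ge0 p (1 / 2).
move: (beta_at p 1) (beta_at p (1 / 2)) A0 b0 H => A b A0 b0 H.
have lnZ0 : 0 <= ln Z by exact: ln_ge0.
have pA0 : 0 < p / A by rewrite divr_gt0.
have Ap0 : 0 < A / p by rewrite divr_gt0.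
pose C2 := 1 + 2 * (p / A); have C20 : 0 < C2 by rewrite /C2; lra.
have C2b0 : 0 <= C2 * b by rewrite mulr_ge0// ltW.
pose C3 := 2 * (p / A); have C30 : 0 < C3 by rewrite /C3; lra.
pose D := (C2 * b + 3 + 5 * (1 + ln Z)) / p + 2 + 5 * (C3 + 16).
(* The three terms of W give x <= 1/2, T >= 1, and the condition that the
   tails are small. *)
pose W := 2 + A / p + 6 * (C2 * b + 4) / p.
exists D, W => n w nE Ww.
have W3 : 0 <= 6 * (C2 * b + 4) / p by rewrite divr_ge0 ?(ltW p0)//; lra.
have [w2 wA wC] : [/\ 2 <= w, A / p <= w & 6 * (C2 * b + 4) / p <= w].
  by split; move: Ww; rewrite /W; lra.
have w0 : 0 < w by lra.
have w1 : 1 <= w by lra.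
have wpow i j : (i <= j)%N -> w ^+ i <= w ^+ j by move=> ij; rewrite ler_weXn2l.
have wi0 i : 0 < w ^+ i by exact: exprn_gt0.
have n0 : 0 < n%:R :> R by rewrite nE.
pose x := w ^- 2; pose c := n%:R / (1 - x).
have x0 : 0 < x by rewrite invr_gt0.
have x1 : x <= 1 / 2.
  rewrite /x ler_pdivlMr// mulrC ler_pdivrMr// mul1r expr2; nra.
have x01 : 0 < x <= 1 / 2 by rewrite x0 x1.
have x1' : 0 < 1 - x by lra.
have c0 : 0 < c by rewrite divr_gt0.
have ncE : n%:R = (1 - x) * c by rewrite mulrC divfK// gt_eqF.
have nc : n%:R <= c by rewrite ncE ler_piMl//; lra.
have c2n : c <= 2 * n%:R.
  by rewrite ncE mulrA ler_peMl ?(ltW c0)//; lra.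
pose T := p * c / A.
have T1 : 1 <= T.
  rewrite /T mulrAC -ler_pdivrMl// mulr1 invf_div.
  apply: le_trans wA _; apply: le_trans nc.
  by rewrite nE -[leLHS]expr1; exact: wpow.
have T0 : 0 < T by lra.
have TC3 : T <= C3 * n%:R.
  have -> : C3 * n%:R = p * (2 * n%:R) / A by rewrite /C3; ring.
  by rewrite ler_pM2r ?invr_gt0// ler_pM2l.
set q := T `^ (1 / 2).
have q0 : 0 <= q by exact: powR_ge0.
have qq : q ^+ 2 = T.
  rewrite -powR_mulrn// -powRrM (_ : 1 / 2 * 2%:R = 1) ?powRr1 ?(ltW T0)//.
  by field.
have qle : q <= C2 * w ^+ 8.
  have B0 : 0 <= C2 * w ^+ 8 by rewrite mulr_ge0// ltW.
  suff : q ^+ 2 <= (C2 * w ^+ 8) ^+ 2 by rewrite ler_sqr ?nnegrE.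
  rewrite qq (le_trans TC3)// nE exprMn -exprM ler_wpM2r ?(ltW (wi0 _))//.
  by rewrite /C2 /C3; nra.
have qb : q * b <= C2 * b * w ^+ 8 by rewrite mulrAC ler_wpM2r.
have Tx : q * b + 4 <= p * c * x ^+ 2 / 6.
  apply: (@le_trans _ _ ((C2 * b + 4) * w ^+ 8)).
    rewrite mulrDl lerD// -[leLHS]mulr1 ler_wpM2l//.
    by rewrite -[leLHS](expr1n _ 8) lerXn2r ?nnegrE// ltW.
  have -> : p * c * x ^+ 2 / 6 = p / 6 * (c * x ^+ 2) by ring.
  have cx : w ^+ 12 <= c * x ^+ 2.
    have -> : w ^+ 12 = n%:R * x ^+ 2.
      by rewrite nE /x; field; rewrite gt_eqF.
    by rewrite ler_wpM2r ?sqr_ge0.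
  apply: (@le_trans _ _ (p / 6 * w ^+ 12)); last first.
    by rewrite ler_wpM2l// divr_ge0// ltW.
  have -> : p / 6 * w ^+ 12 = p / 6 * w ^+ 4 * w ^+ 8 by ring.
  rewrite ler_wpM2r ?(ltW (wi0 _))//.
  have w4 : w <= w ^+ 4 by rewrite -[leLHS]expr1 wpow.
  have := le_trans wC w4; rewrite ler_pdivrMr//; lra.
have [N HN] := H x c n x01 c0 ncE T1 Tx.
exists N; apply: le_trans HN; rewrite ler_expR -/T -/q.
pose r := w ^+ 15.
have rE : r * w = n%:R by rewrite nE /r -exprSr.
have nw : n%:R / w = r by rewrite -rE mulfK// gt_eqF.
have r1 : 1 <= r by rewrite -[leLHS](expr1n _ 15) lerXn2r ?nnegrE// ltW.
have wr : w ^+ 8 <= r by exact: wpow.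
set y := 2 * x * c + 1.
have y0 : 0 < y by rewrite /y; have := mulr_gt0 x0 c0; lra.
have yw : y * w <= 5 * r.
  have xcw : x * c * w <= 2 * r.
    apply: (@le_trans _ _ (x * (2 * n%:R) * w)).
      by rewrite ler_pM2r// ler_pM2l.
    rewrite nE /x /r le_eqVlt; apply/orP; left; apply/eqP.
    by field; rewrite gt_eqF.
  have : w <= r by rewrite /r -[leLHS]expr1 wpow.
  by rewrite /y; lra.
have y5 : y <= 5 * r by apply: le_trans yw; rewrite ler_peMr// ltW.
have lnT2 : ln T <= C3 + 16 * w.
  apply: (@le_trans _ _ (ln (C3 * n%:R))).
    have Cn0 : 0 < C3 * n%:R by exact: mulr_gt0.
    by rewrite ler_ln ?posrE.
  rewrite nE lnM ?posrE// lnXn// -(mulr_natl (ln w)).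
  have h1 := ln_sublinear C30; have h2 := ln_sublinear w0.
  by rewrite lerD ?(ltW h1)// ler_wpM2l// ltW.
have lnT1 : ln T <= - ln (A / p) + ln n%:R + 2 / w.
  have -> : ln T = - ln (A / p) + (ln n%:R - ln (1 - x)).
    have -> : T = n%:R / (1 - x) / (A / p).
      by rewrite /T /c; field; rewrite !gt_eqF.
    rewrite (@ln_div _ (n%:R / (1 - x))) ?posrE// (@ln_div _ n%:R) ?posrE//.
    by ring.
  rewrite addrA lerD2l.
  have h := ln_ge_1subrV x1'.
  have h2 : (1 - x)^-1 <= 1 + 2 * x.
    by rewrite -[leLHS]mul1r ler_pdivrMr//; nra.
  have xw : x <= w^-1.
    by rewrite /x lef_pV2 ?posrE// -[leLHS]expr1 wpow.
  lra.
have lnT0 : 0 <= ln T by exact: ln_ge0.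
have yT : y * ln T <= 5 * (C3 + 16) * r.
  apply: (@le_trans _ _ (y * (C3 + 16 * w))); first by rewrite ler_pM2l.
  have := ler_wpM2l (ltW C30) y5; lra.
have yZ : y * (1 + ln Z) <= 5 * r * (1 + ln Z).
  by rewrite ler_wpM2r//; lra.
have qbr : q * b <= C2 * b * r by apply: (le_trans qb); rewrite ler_wpM2l.
have pn0 : 0 < p * n%:R by exact: mulr_gt0.
have pnT : p * n%:R * ln T <= p * n%:R * (- ln (A / p) + ln n%:R) + p * (2 * r).
  have := ler_wpM2l (ltW pn0) lnT1.
  have -> : p * n%:R * (- ln (A / p) + ln n%:R + 2 / w) =
    p * n%:R * (- ln (A / p) + ln n%:R) + p * (2 * (n%:R / w)) by ring.
  by rewrite nw.
have pyT : p * (y * ln T) <= p * (5 * (C3 + 16) * r) by rewrite ler_pM2l.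
have pc : p * n%:R <= p * c by rewrite ler_pM2l.
have -> : p * n%:R * (1 + ln (A / p) - ln n%:R - D / w) =
  p * n%:R - p * n%:R * (- ln (A / p) + ln n%:R) - p * D * (n%:R / w) by ring.
have pD : p * D * (n%:R / w) = (C2 * b + 3 + 5 * (1 + ln Z)) * r + p * (2 * r) +
    p * (5 * (C3 + 16) * r).
  by rewrite nw /D; field; rewrite gt_eqF.
rewrite pD.
have -> : p * (n%:R + y) * ln T = p * n%:R * ln T + p * (y * ln T) by ring.
have -> : (C2 * b + 3 + 5 * (1 + ln Z)) * r =
  C2 * b * r + 3 * r + 5 * r * (1 + ln Z) by ring.
have r3 : 3 <= 3 * r by lra.
lra.
Qed.

(** * The limit *)

Lemma root16_cvgy {R : realType} : (n%:R : R) `^ (1 / 16) @[n --> \oo] --> +oo.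
Proof.
apply/cvgryPge => B.
have : \forall n \near \oo, `|B| ^+ 16 <= n%:R :> R.
  by move/cvgryPge: (@cvgr_idn R); apply.
apply: filterS => n Bn; apply: le_trans (ler_norm B) _.
have -> : `|B| = (`|B| ^+ 16) `^ (1 / 16).
  by rewrite -powR_mulrn// -powRrM (_ : 16%:R * (1 / 16) = 1) ?powRr1//; field.
by apply: ge0_ler_powR; rewrite ?nnegrE ?exprn_ge0.
Qed.

Theorem theorem2 (R : realType) (p : R) (hp : 1 < p) :
  k p n @[n --> \oo] -->
    (expR 1 / p * euler_beta (1 / (2 * p)) (1 - 1 / p))%:E.
Proof.
have p0 : 0 < p by lra.
have A0 := beta_at1_gt0 hp; rewrite -/(beta_at p 1).
have [D [W DW]] := trunc_sum_ge_optimal hp.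
have kF n := @trunc_sum_le_optimal _ p n hp.
have kB n E F := @k_between _ p E F n hp.
move: (beta_at p 1) A0 DW kF => A A0 DW kF.
pose w (n : nat) : R := n%:R `^ (1 / 16).
have wE n : n%:R = w n ^+ 16.
  rewrite /w -powR_mulrn ?powR_ge0// -powRrM (_ : 1 / 16 * 16%:R = 1) ?powRr1//.
  by field.
have Ap0 : 0 < A / p by rewrite divr_gt0.
have -> : expR 1 / p * A = expR (1 + ln (A / p)).
  by rewrite expRD lnK ?posrE//; ring.
have exp_cvg (u : nat -> R) : u n @[n --> \oo] --> 0 ->
    (expR (1 + ln (A / p) + u n))%:E @[n --> \oo] -->
    (expR (1 + ln (A / p)))%:E.
  move=> u0; apply: cvg_EFin; first exact: nearW.
  apply: (@continuous_cvg _ _ _ _ _ (fun n => 1 + ln (A / p) + u n) expR).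
    exact: continuous_expR.
  by rewrite -[X in _ --> X]addr0; apply: cvgD => //; exact: cvg_cst.
have n_gt0 : \forall n \near \oo, (0 < n)%N by exists 1%N.
have invn_cvg0 : (n%:R : R)^-1 @[n --> \oo] --> 0.
  apply/gtr0_cvgV0; last exact: cvgr_idn.
  by apply: filterS n_gt0 => n; rewrite ltr0n.
have invw_cvg0 : (w n)^-1 @[n --> \oo] --> 0.
  apply/gtr0_cvgV0; last exact: root16_cvgy.
  by apply: filterS n_gt0 => n n0; rewrite powR_gt0 ?ltr0n.
have lower_cvg : - (D / w n) @[n --> \oo] --> 0.
  rewrite -[X in _ --> X]oppr0 -[X in _ --> - X](mulr0 D).
  by apply: cvgN; apply: cvgMr.
have upper_cvg : p^-1 / n%:R @[n --> \oo] --> 0.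
  by rewrite -[X in _ --> X](mulr0 p^-1); apply: cvgMr.
apply: (squeeze_cvge _ (exp_cvg _ lower_cvg) (exp_cvg _ upper_cvg)).
have W_le : \forall n \near \oo, W <= w n.
  by move/cvgryPge: (@root16_cvgy R); apply.
apply: filterS2 n_gt0 W_le => n n0 Ww.
have lower := DW n (w n) (wE n) Ww.
have n0' : 0 < n%:R :> R by rewrite ltr0n.
have np0 : n%:R * p != 0 by rewrite gt_eqF// mulr_gt0.
have wn0 : w n != 0 by rewrite gt_eqF// powR_gt0.
have lnE : ln (p * n%:R / A) = ln n%:R - ln (A / p).
  by rewrite -ln_div ?posrE//; congr ln; field; rewrite !gt_eqF.
have := kB n _ _ n0 lower (kF n n0); rewrite lnE.
set e1 := ln _ + _; set e2 := ln _ + _.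
have -> : e1 = 1 + ln (A / p) + - (D / w n).
  by rewrite /e1; field; rewrite wn0 !gt_eqF.
have -> // : e2 = 1 + ln (A / p) + p^-1 / n%:R.
by rewrite /e2; field; rewrite !gt_eqF.
Qed.
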